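(* Let $H=(V,E)$ be a connected hypergraph without empty edges, and $G=\mathcal{G}(H)$ its incidence graph. For any $v\in V$: $v$ is a separating vertex of $H$ if and only if $v$ is a cut vertex of $G$.
   Context: A hypergraph $H=(V,E)$ consists of a nonempty finite vertex set $V$, a finite edge set $E$, and an incidence function $\psi:E\to 2^V$; edges are identified with their vertex sets (parallel edges allowed); an empty edge has empty vertex set. Two distinct vertices are adjacent via $e$ if both lie in $e$; a walk is a sequence $v_0e_1v_1\dots e_kv_k$ with $v_{i-1},v_i$ adjacent via $e_i$; $H$ is connected if any two distinct vertices are joined by a walk. A hypersubgraph of $H$ is a hypergraph $(V',E')$ with $V'\subseteq V$, $E'\subseteq E$. A vertex $v$ is a separating vertex of $H$ if there are two connected hypersubgraphs $H_1,H_2$ of $H$, each with at least one edge, such that $E(H_1)\cap E(H_2)=\emptyset$, $V=V(H_1)\cup V(H_2)$, $E=E(H_1)\cup E(H_2)$, and $V(H_1)\cap V(H_2)=\{v\}$. The incidence graph $\mathcal{G}(H)$ is the bipartite graph with vertex set $V\cup E$ and edge set $\{ve:v\in e\}$; a cut vertex of a graph is a vertex whose deletion increases the number of connected components. *)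

(* Defs.v *)
From HB Require Import structures.
From mathcomp Require Import all_boot.

Set Implicit Arguments.
Unset Strict Implicit.
Unset Printing Implicit Defensive.

(* Simple finite graphs; the vertex type may be empty, so that vertices can
   always be deleted. *)
Record sgraph := SGraph {
  gvertex : finType;
  gadj : rel gvertex;
  gadj_sym : symmetric gadj;
  gadj_irr : irreflexive gadj }.

Definition num_components (G : sgraph) : nat := n_comp (@gadj G) predT.

Section DelVertex.
Variables (G : sgraph) (v : gvertex G).

Definition del_adj : rel {x : gvertex G | x != v} :=
  fun x y => gadj (val x) (val y).

Lemma del_adj_sym : symmetric del_adj.
Proof. by move=> x y; apply: gadj_sym. Qed.

Lemma del_adj_irr : irreflexive del_adj.
Proof. by move=> x; apply: gadj_irr. Qed.

Definition del_vertex : sgraph := SGraph del_adj_sym del_adj_irr.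

Definition cut_vertex : Prop := num_components G < num_components del_vertex.

End DelVertex.

(* Distinct edges may have the same vertex set, and [incid e] may be empty. *)
Record hypergraph := Hypergraph {
  vertex : finType;
  edge : finType;
  incid : edge -> {set vertex};
  vertex_gt0 : 0 < #|vertex| }.

Definition adjacent_via (H : hypergraph) (e : edge H) (u w : vertex H) : bool :=
  [&& u != w, u \in incid e & w \in incid e].

(* The walk v_0 e_1 v_1 ... e_k v_k is encoded by its origin v_0 and the
   sequence of pairs (e_1, v_1), ..., (e_k, v_k). *)
Fixpoint is_walk (H : hypergraph) (u : vertex H) (p : seq (edge H * vertex H)) :
    bool :=
  if p is (e, w) :: p' then adjacent_via e u w && is_walk w p' else true.

Definition walk_end (H : hypergraph) (u : vertex H)
    (p : seq (edge H * vertex H)) : vertex H :=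
  last u [seq ew.2 | ew <- p].

Definition connected (H : hypergraph) : Prop :=
  forall u w : vertex H, u != w ->
  exists2 p : seq (edge H * vertex H), is_walk u p & walk_end u p = w.

Definition no_empty_edge (H : hypergraph) : Prop :=
  forall e : edge H, incid e != set0.

(* A hypersubgraph is itself a hypergraph with the inherited incidence
   function: it has a vertex, and contains all the vertices of its edges. *)
Record hypersubgraph (H : hypergraph) := Hypersubgraph {
  sub_vertices : {set vertex H};
  sub_edges : {set edge H};
  sub_vertices_neq0 : sub_vertices != set0;
  sub_incid_subset :
    forall e, e \in sub_edges -> incid e \subset sub_vertices }.

Section HypergraphOfSub.
Variables (H : hypergraph) (K : hypersubgraph H).

Definition sub_vertex : finType := {x : vertex H | x \in sub_vertices K}.
Definition sub_edge : finType := {e : edge H | e \in sub_edges K}.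

(* By [sub_incid_subset], taking the trace on [sub_vertices K] loses no
   vertex of [e]. *)
Definition sub_incid (e : sub_edge) : {set sub_vertex} :=
  [set x : sub_vertex | val x \in incid (val e)].

Lemma sub_vertex_gt0 : 0 < #|sub_vertex|.
Proof. by rewrite card_sig card_gt0 (sub_vertices_neq0 K). Qed.

Definition hypergraph_of_sub : hypergraph :=
  @Hypergraph sub_vertex sub_edge sub_incid sub_vertex_gt0.

End HypergraphOfSub.

Definition separating_vertex (H : hypergraph) (v : vertex H) : Prop :=
  exists H1 H2 : hypersubgraph H,
  [/\ connected (hypergraph_of_sub H1) /\ connected (hypergraph_of_sub H2),
      sub_edges H1 != set0 /\ sub_edges H2 != set0,
      sub_edges H1 :&: sub_edges H2 = set0,
      sub_vertices H1 :|: sub_vertices H2 = [set: vertex H] /\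
      sub_edges H1 :|: sub_edges H2 = [set: edge H]
    & sub_vertices H1 :&: sub_vertices H2 = [set v]].

Section IncidenceGraph.
Variable H : hypergraph.

Definition incidence_adj : rel (vertex H + edge H)%type := fun x y =>
  match x, y with
  | inl v, inr e => v \in incid e
  | inr e, inl v => v \in incid e
  | _, _ => false
  end.

Lemma incidence_adj_sym : symmetric incidence_adj.
Proof. by move=> [v|e] [w|f]. Qed.

Lemma incidence_adj_irr : irreflexive incidence_adj.
Proof. by move=> [v|e]. Qed.

Definition incidence_graph : sgraph :=
  SGraph incidence_adj_sym incidence_adj_irr.

End IncidenceGraph.

(* Main.v *)
(* Deleting [v] disconnects the incidence graph exactly when the edges of [H]
   fall into two nonempty classes such that every vertex other than [v] meets
   edges of one class only. Each class, together with [v] and its own vertices,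
   spans a connected hypersubgraph, because a walk of [H] towards [v] cannot
   leave its class before it reaches [v]. *)
Require Import Defs.
From mathcomp Require Import all_boot.

Set Implicit Arguments.
Unset Strict Implicit.
Unset Printing Implicit Defensive.

Lemma sgraph_connect_sym (G : sgraph) : connect_sym (@gadj G).
Proof. exact: sym_connect_sym (@gadj_sym G). Qed.

Lemma num_components_gt0 (G : sgraph) (x : gvertex G) : 0 < num_components G.
Proof.
apply/card_gt0P; exists (root (@gadj G) x).
by rewrite !inE andbT roots_root //; apply: sgraph_connect_sym.
Qed.

Lemma num_components_gt1P (G : sgraph) :
  reflect (exists x y, ~~ connect (@gadj G) x y) (1 < num_components G).
Proof.
have symG := @sgraph_connect_sym G.
apply: (iffP (@card_gt1P _ _)) => [[x [y [xr yr xy]]]|[x [y xy]]].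
  exists x, y; rewrite -(root_connect symG).
  by move: xr yr; rewrite !inE !andbT => /eqP-> /eqP->.
exists (root (@gadj G) x), (root (@gadj G) y).
by rewrite !inE !andbT !(roots_root symG) (root_connect symG).
Qed.

Definition hadj (H : hypergraph) : rel (vertex H) :=
  fun u w => [exists e, adjacent_via e u w].

Lemma hadj_sym (H : hypergraph) : symmetric (@hadj H).
Proof.
move=> u w; apply: eq_existsb => e.
by rewrite /adjacent_via eq_sym [X in _ && X]andbC.
Qed.

(** Trades explicit walks for [connect]. The case [u = w], which [connected] leaves out, is the
    empty path. *)
Lemma connected_hadjP (H : hypergraph) :
  connected H <-> forall u w, connect (@hadj H) u w.
Proof.
split=> connH u w.
  have [-> //|/connH[p]] := eqVneq u w.
  elim: p u => [|[e x] p IHp] u /=; first by move=> _ <-.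
  case/andP=> ux xp px; apply: connect_trans (IHp x xp px).
  by apply/connect1/existsP; exists e.
move=> _; have /connectP[p] := connH u w.
elim: p u => [|x p IHp] u /=; first by move=> _ ->; exists [::].
case/andP=> /existsP[e ux] xp wp; have [q xq qw] := IHp x xp wp.
by exists ((e, x) :: q) => //=; rewrite ux.
Qed.

Lemma incident_edge (H : hypergraph) (u w : vertex H) :
  connected H -> u != w -> exists e, u \in incid e.
Proof.
move=> connH uw; have [[|[e x] p] /= ]:= connH _ _ uw.
  by move=> _ uw'; rewrite -uw' eqxx in uw.
by case/andP=> /and3P[_ ue _] _ _; exists e.
Qed.

(** A step of a walk from [u] to [x] via [e] becomes the two graph edges [u e] and [e x]. Since no
    edge is empty, every edge node is next to a vertex node. *)
Lemma incidence_graph_connected (H : hypergraph) :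
  connected H -> no_empty_edge H ->
  forall x y, connect (@gadj (incidence_graph H)) x y.
Proof.
move=> /connected_hadjP connH neH.
set G := incidence_graph H; have symG := @sgraph_connect_sym G.
have connV (u w : vertex H) : connect (@gadj G) (inl u) (inl w).
  have /connectP[p] := connH u w.
  elim: p u => [|x p IHp] u /=; first by move=> _ ->.
  case/andP=> /existsP[e /and3P[_ ue xe]] xp wp.
  apply: connect_trans (IHp x xp wp).
  by apply: (@connect_trans _ _ (inr e)); apply: connect1.
have toV (x : gvertex G) : exists w : vertex H, connect (@gadj G) x (inl w).
  case: x => [w|e]; first by exists w.
  by have /set0Pn[w we] := neH e; exists w; apply: connect1.
move=> x y; have [[u xu] [w yw]] := (toV x, toV y).
by apply: connect_trans xu (connect_trans (connV u w) _); rewrite symG.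
Qed.

(** The incidence graph has exactly one component, so the number grows exactly when the deletion
    leaves at least two. *)
Lemma cut_vertexP (H : hypergraph) (v : vertex H) :
  connected H -> no_empty_edge H ->
  @cut_vertex (incidence_graph H) (inl v) <->
  exists x y, ~~ connect (@gadj (@del_vertex (incidence_graph H) (inl v))) x y.
Proof.
move=> connH neH; rewrite /cut_vertex.
suff ->: num_components (incidence_graph H) = 1.
  by split=> /num_components_gt1P.
apply/eqP; rewrite eqn_leq num_components_gt0 ?andbT; last exact: (inl v).
rewrite leqNgt; apply/num_components_gt1P=> -[x [y]].
by rewrite incidence_graph_connected.
Qed.

Section Branch.
Variables (H : hypergraph) (v : vertex H).

(** Stated as an equality of memberships, the condition passes to complements, so one branch
    provides both sides of the separation. Whether [v] is in [A] is left open. *)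
Definition branch (A : {set vertex H}) (B : {set edge H}) :=
  forall e x, x \in incid e -> x != v -> (x \in A) = (e \in B).

Lemma branchC A B : branch A B -> branch (~: A) (~: B).
Proof. by move=> AB e x xe xv; rewrite !inE (AB e). Qed.

Lemma branch_neq0 A : v |: A != set0.
Proof. by apply/set0Pn; exists v; rewrite setU11. Qed.

Lemma branch_incid A B : branch A B ->
  forall e, e \in B -> incid e \subset v |: A.
Proof.
move=> AB e eB; apply/subsetP=> x xe; rewrite !inE.
by have [//|xv] := eqVneq x v; rewrite (AB e).
Qed.

Definition branch_sub A B (AB : branch A B) : hypersubgraph H :=
  Hypersubgraph (branch_neq0 A) (branch_incid AB).

Lemma branch_connected A B (AB : branch A B) :
  connected H -> connected (hypergraph_of_sub (branch_sub AB)).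
Proof.
move=> /connected_hadjP connH; apply/connected_hadjP.
set K := hypergraph_of_sub _.
pose v' : vertex K := Sub v (setU11 v A).
have symK := sym_connect_sym (@hadj_sym K).
suff toV (u : vertex K) : connect (@hadj K) u v'.
  by move=> u w; apply: connect_trans (toV u) _; rewrite symK.
have /connectP[p] := connH (val u) v.
elim: p u => [|x p IHp] u /=.
  by move=> _ vu; rewrite (_ : u = v') //; apply: val_inj.
case/andP=> /existsP[e /and3P[ux ue xe]] xp vp.
(* Once the walk is at [v], the rest of it is discarded. Before that, [u] is in [A], so the next
   edge is in [B] and the next vertex stays in [v |: A]. *)
have [uv|uv] := eqVneq (val u) v.
  by rewrite (_ : u = v') //; apply: val_inj.
have eB : e \in B.
  by rewrite -(AB e (val u)) //; have := valP u; rewrite !inE (negPf uv).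
have xA : x \in v |: A by apply: (subsetP (branch_incid AB eB)).
apply: connect_trans (IHp (Sub x xA) xp vp).
apply/connect1/existsP; exists (Sub e eB : edge K).
by rewrite /adjacent_via /= !inE /= ue xe -val_eqE ux.
Qed.

Lemma branch_separating A B : branch A B -> connected H ->
  B != set0 -> ~: B != set0 -> separating_vertex v.
Proof.
move=> AB connH B0 BC0; exists (branch_sub AB), (branch_sub (branchC AB)).
split=> //=; first by split; apply: branch_connected.
- exact: setICr.
- by rewrite -setUUr !setUCr setUT.
- by rewrite -setUIr setICr setU0.
Qed.

End Branch.

Theorem theorem3p32 (H : hypergraph) (connH : connected H)
    (neH : no_empty_edge H) (v : vertex H) :
  separating_vertex v <-> @cut_vertex (incidence_graph H) (inl v).
Proof.
apply: (iff_trans _ (iff_sym (cut_vertexP v connH neH))); set D := del_vertex _.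
pose edgeD (e : edge H) : gvertex D := exist _ (inr e) isT.
split=> [[H1 [H2 [_ [/set0Pn[e1 e1H] /set0Pn[e2 e2H]] E0 [_ ET] Vv]]]|].
  (* One edge from each side. They are separated by the set [C] of nodes coming from [H1], which is
     closed under adjacency once [v] is gone. *)
  exists (edgeD e1), (edgeD e2).
  pose C : pred (gvertex D) := fun x => match val x with
    | inl u => u \in sub_vertices H1 | inr e => e \in sub_edges H1 end.
  have incC e u : u != v -> u \in incid e ->
      (u \in sub_vertices H1) = (e \in sub_edges H1).
    (* If [u] is in [H1] and [e] were an edge of [H2], then [u] would be a common vertex of both,
       that is, [v]. *)
    move=> uv ue; apply/idP/idP=> [u1|/sub_incid_subset/subsetP->//].
    have: e \in [set: edge H] by [].
    rewrite -ET inE => /orP[//|/sub_incid_subset/subsetP/(_ u ue) u2].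
    by have := in_set1 u v; rewrite -Vv inE u1 u2 (negPf uv).
  have closedC : closed (@gadj D) C.
    by move=> [[x|e] xv] [[y|f] yv] //= xy; rewrite -!topredE /C /=;
      [|symmetry]; apply: incC.
  apply/negP=> /(closed_connect closedC); rewrite -!topredE /C /= e1H => e2H1.
  by have := in_set0 e2; rewrite -E0 inE -e2H1 e2H.
move=> [a [b ab]].
(* The component of [a] after the deletion, viewed in the whole incidence graph so that membership
   needs no proof of being distinct from [v]. *)
pose C := [set val y | y in connect (@gadj D) a].
have memC (y : gvertex D) : (val y \in C) = connect (@gadj D) a y.
  exact: (mem_imset _ _ val_inj).
pose A := [set x : vertex H | inl x \in C].
pose B := [set e : edge H | inr e \in C].
have AB : branch v A B.
  move=> e x xe xv; rewrite !inE.
  pose xD : gvertex D := exist _ (inl x) xv.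
  have xeD : gadj xD (edgeD e) by [].
  rewrite (memC xD) (memC (edgeD e)).
  exact/same_connect1r/xeD/sgraph_connect_sym.
(* [a] and [b] may be vertices of [H]. Each of them then lies in some edge, which is on the same
   side of [C]; hence [B] and its complement both contain an edge. *)
have toE (y : gvertex D) :
    exists e, (e \in B) = connect (@gadj D) a y.
  rewrite -memC; case: y => [[x|e] /= xv]; last by exists e; rewrite inE.
  have [e xe] := incident_edge connH (xv : x != v).
  by exists e; rewrite -(AB e x) // inE.
have [[e ea] [f fb]] := (toE a, toE b).
apply: (branch_separating AB) => //; apply/set0Pn.
- by exists e; rewrite ea connect0.
- by exists f; rewrite inE fb.
Qed.
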